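(* Let $(M,g)$ be an almost FLRW universe with line element $$ds^2=a^2(\tau)\big\{-(1+2A)\,d\tau^2+(1-2A)\,\delta_{ij}dx^idx^j\big\}$$ and energy-momentum tensor of a perfect fluid with energy density $\rho$ and pressure $p$, i.e. $$T_{ij}=p\,a^2(1-2A)\delta_{ij},\qquad T_{i0}=0,\qquad T_{00}=a^2(1+2A)\rho$$ (components with respect to $\partial/\partial x^0=\partial/\partial\tau$, $\partial/\partial x^i$). Let $G=\mathrm{Ric}-\tfrac12\mathbf R g$, with $\mathrm{Ric}$ and $\mathbf R$ the Ricci tensor and scalar curvature of $g$, and let $\Lambda,\mathbf G$ be constants (the cosmological constant and the Newton constant). Then: (i) The spatial (components $ij$), mixed (components $i0$) and temporal (component $00$) Einstein field equations of $(M,g)$, into which $G+\Lambda g=8\pi\mathbf G\,T$ splits, are given, respectively, by ($i,j\in\{1,2,3\}$) $$\begin{aligned}&\frac{2}{1-4A^2}\Big\{2AA_{ij}+\frac{1+4A+12A^2}{1-4A^2}A_iA_j\Big\}\\&+\delta_{ij}\Big\{\frac1{1+2A}\Big(2A''+\frac{6+4A}{1+2A}\mathcal HA'+\frac{6A-1}{1-4A^2}(A')^2-(1-2A)(\mathcal H^2+2\mathcal H')\Big)\\&\qquad-\frac1{1-4A^2}\Big(4A\sum_{k=1}^3A_{kk}+\frac{3+4A+12A^2}{1-4A^2}\sum_{k=1}^3(A_k)^2\Big)\Big\}=(8\pi\mathbf Gp-\Lambda)\,a^2(1-2A)\,\delta_{ij},\end{aligned}$$ $$(1+6A)A'A_i+(1-4A^2)A_i'+(1-2A)^2\mathcal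 HA_i=0,$$ $$\frac{1+2A}{(1-2A)^3}\sum_{k=1}^3\big\{3(A_k)^2+2(1-2A)A_{kk}\big\}+3\Big(\mathcal H-\frac{A'}{1-2A}\Big)^2=a^2(1+2A)(\Lambda+8\pi\mathbf G\rho).$$ (ii) The Raychaudhuri–Ehlers equation in $(M,g)$ is given by $$\begin{aligned}&3\Big\{\mathcal H'-\frac1{1-2A}A''-\frac{1}{1-4A^2}\mathcal HA'-\frac{4A}{(1-2A)(1-4A^2)}(A')^2\Big\}\\&-\frac1{1-2A}\Big\{\sum_{k=1}^3A_{kk}-\frac2{1-4A^2}\sum_{k=1}^3(A_k)^2\Big\}=a^2(1+2A)\big(\Lambda-4\pi\mathbf G(\rho+3p)\big).\end{aligned}$$
   Context: $x^0=\tau$ is conformal time, $(x^1,x^2,x^3)$ are Cartesian spatial coordinates, $a=a(\tau)>0$ is the scale factor, and $A=A(\tau,x^1,x^2,x^3)$ is a smooth function (Bardeen invariant) such that $g$ is a Lorentz metric with $\partial/\partial\tau$ timelike, i.e. $1+2A>0$ and $1-2A>0$. (In general the almost FLRW metric in conformal-Newtonian gauge is $a^2\{-(1+2A)d\tau^2+(1-2B)\delta_{ij}dx^idx^j\}$ with Bardeen invariants $A,B$; in the perfect-fluid case one has $B=A$, and this is imposed.) A prime denotes $\partial/\partial\tau$, $A_i=\partial A/\partial x^i$, $A_{ij}=\partial^2A/\partial x^i\partial x^j$, $A_i'=\partial^2A/\partial\tau\partial x^i$, and $\mathcal H=a'/a$ is the Hubble parameter of the background metric. The Raychaudhuri–Ehlers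 equation is the general equation $$\Theta_{|0}+\tfrac13\Theta^2+\sigma^2-\Psi\Theta-\Phi^2\{b^2+b^k{}_{|k}+\Phi^2\omega^2+\Lambda-4\pi\mathbf G(\rho+3p)\}=0,$$ obtained from the Einstein field equations, where for this metric: $\Phi^2=a^2(1+2A)$, $\Psi=\Phi^{-1}\partial\Phi/\partial\tau$; spatial metric $\bar g_{ij}=a^2(1-2A)\delta_{ij}$; expansion $\Theta_{ij}=\tfrac12\partial\bar g_{ij}/\partial\tau$, $\Theta=\bar g^{ij}\Theta_{ij}$, $\Theta_{|0}=\partial\Theta/\partial\tau$; shear and vorticity are zero ($\sigma^2=\omega^2=0$); $b_i=\Phi^{-1}\partial\Phi/\partial x^i$, $b^2=\bar g^{ij}b_ib_j$, and $b^k{}_{|k}$ is the divergence of $b^k=\bar g^{ki}b_i$ with respect to the Levi-Civita connection of $\bar g_{ij}$ on the slices $\tau=\text{const}$.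
   Formalization: In (ii), the coefficient of the term HA' in the first brace is corrected from the printed −1/(1−4A²) to −2/(1−4A²); the printed equation fails, e.g., for a=1+τ, A=τ/10 at τ=0. *)

(* Defs.v *)
From HB Require Import structures.
From mathcomp Require Import all_boot all_order all_algebra.
From mathcomp Require Import all_classical all_reals all_analysis.
Set Implicit Arguments.
Unset Strict Implicit.
Unset Printing Implicit Defensive.
Import Order.TTheory GRing.Theory Num.Theory.
Import numFieldNormedType.Exports.
Local Open Scope classical_set_scope.
Local Open Scope ring_scope.

(* Tensor calculus in a global chart.  A scalar field is a function on
   'rV[R]_n, a metric is a function from 'rV[R]_n to 'M[R]_n; all operators
   are local, so only the values near a point matter. *)
Section Calculus.
Variables (R : realType) (n : nat).
Implicit Types (f : 'rV[R]_n -> R) (g : 'rV[R]_n -> 'M[R]_n) (i j k l : 'I_n).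

Definition partial i f (x : 'rV[R]_n) : R := 'D_(delta_mx 0 i) f x.

Definition partials (s : seq 'I_n) f : 'rV[R]_n -> R := foldr partial f s.

(* C^oo on U (meant for U open): the partial derivatives of all orders exist
   and are continuous at every point of U. *)
Definition smooth_on (U : set 'rV[R]_n) f : Prop :=
  forall (s : seq 'I_n) (x : 'rV[R]_n), U x ->
    {for x, continuous (partials s f)} /\
    (forall i, derivable (partials s f) x (delta_mx 0 i)).

(* Gamma^k_ij of the Levi-Civita connection of g *)
Definition christoffel g k i j (x : 'rV[R]_n) : R :=
  2^-1 * \sum_l invmx (g x) k l *
    (partial i (fun y => g y j l) x + partial j (fun y => g y i l) x
     - partial l (fun y => g y i j) x).

(* R^k_(l i j), with R(d_i, d_j) d_l = R^k_(l i j) d_k and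
   R(X, Y) = [nabla_X, nabla_Y] - nabla_[X, Y] *)
Definition riemann g k l i j (x : 'rV[R]_n) : R :=
  partial i (christoffel g k j l) x - partial j (christoffel g k i l) x
  + \sum_m (christoffel g k i m x * christoffel g m j l x
            - christoffel g k j m x * christoffel g m i l x).

Definition ricci g (x : 'rV[R]_n) : 'M[R]_n :=
  \matrix_(i, j) \sum_k riemann g k i k j x.

Definition scalar_curvature g (x : 'rV[R]_n) : R :=
  \sum_i \sum_j invmx (g x) i j * ricci g x i j.

Definition einstein_tensor g (x : 'rV[R]_n) : 'M[R]_n :=
  ricci g x - (2^-1 * scalar_curvature g x) *: g x.

(* X^k_|k, for a vector field with contravariant components X k *)
Definition divergence g (X : 'I_n -> 'rV[R]_n -> R) (x : 'rV[R]_n) : R :=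
  \sum_k (partial k (X k) x + \sum_l christoffel g k k l x * X l x).

End Calculus.

(* A point of spacetime is x : 'rV[R]_4, with x 0 0 = tau and x^1, x^2, x^3 at
   the indices [sp i], i : 'I_3. *)
Section Spacetime.
Variable R : realType.
Implicit Types (a : R -> R) (A rho p Phi : 'rV[R]_4 -> R) (x : 'rV[R]_4).

Definition sp (i : 'I_3) : 'I_4 := lift ord0 i.

Definition time x : R := x 0 0.
Definition position x : 'rV[R]_3 := \row_i x 0 (sp i).
Definition event (t : R) (y : 'rV[R]_3) : 'rV[R]_4 :=
  row_mx (t%:M : 'rV[R]_1) y.

Definition d_tau (f : 'rV[R]_4 -> R) : 'rV[R]_4 -> R := partial ord0 f.
Definition d_sp (i : 'I_3) (f : 'rV[R]_4 -> R) : 'rV[R]_4 -> R :=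
  partial (sp i) f.

Definition hubble a (t : R) : R := derive1 a t / a t.

Definition lapse_sqr a A x : R := a (time x) ^+ 2 * (1 + 2 * A x).
Definition lapse a A x : R := Num.sqrt (lapse_sqr a A x).
Definition spatial_scale a A x : R := a (time x) ^+ 2 * (1 - 2 * A x).
Definition spatial_metric a A x : 'M[R]_3 := (spatial_scale a A x)%:M.

Definition flrw_metric a A x : 'M[R]_4 :=
  diag_mx (\row_mu if mu == ord0 then - lapse_sqr a A x
                   else spatial_scale a A x).

Definition perfect_fluid a A rho p x : 'M[R]_4 :=
  diag_mx (\row_mu if mu == ord0 then lapse_sqr a A x * rho x
                   else p x * spatial_scale a A x).

Definition einstein_equation (g T : 'rV[R]_4 -> 'M[R]_4) (Lambda G : R)
    (mu nu : 'I_4) x : Prop :=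
  einstein_tensor g x mu nu + Lambda * g x mu nu = 8 * pi * G * T x mu nu.

Section RaychaudhuriEhlers.
(* h is the metric of the slices tau = const, Phi the lapse.  The squared
   vorticity omega_sqr is an argument of the equation, since it is not
   determined by h and Phi; it vanishes when g_(i 0) = 0. *)
Variables (h : 'rV[R]_4 -> 'M[R]_3) (Phi : 'rV[R]_4 -> R).

Definition expansion_tensor x : 'M[R]_3 :=
  \matrix_(i, j) (2^-1 * d_tau (fun y => h y i j) x).

Definition expansion x : R :=
  \sum_i \sum_j invmx (h x) i j * expansion_tensor x i j.

Definition shear x : 'M[R]_3 :=
  expansion_tensor x - (3^-1 * expansion x) *: h x.

(* sigma^2 = sigma_ij sigma^ij, without a factor 1/2, so that
   Theta_ij Theta^ij = Theta^2 / 3 + sigma^2 *)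
Definition shear_sqr x : R :=
  \sum_i \sum_j \sum_k \sum_l
    invmx (h x) i k * invmx (h x) j l * shear x i j * shear x k l.

Definition Psi x : R := (Phi x)^-1 * d_tau Phi x.

Definition b_lower (i : 'I_3) x : R := (Phi x)^-1 * d_sp i Phi x.

Definition b_upper (k : 'I_3) x : R :=
  \sum_i invmx (h x) k i * b_lower i x.

Definition b_sqr x : R :=
  \sum_i \sum_j invmx (h x) i j * b_lower i x * b_lower j x.

Definition b_div x : R :=
  divergence (fun y => h (event (time x) y))
             (fun k y => b_upper k (event (time x) y)) (position x).

Definition raychaudhuri_ehlers (omega_sqr : 'rV[R]_4 -> R) (Lambda G : R)
    rho p x : Prop :=
  d_tau expansion x + 3^-1 * expansion x ^+ 2 + shear_sqr x
  - Psi x * expansion x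
  - Phi x ^+ 2 * (b_sqr x + b_div x + Phi x ^+ 2 * omega_sqr x
                  + Lambda - 4 * pi * G * (rho x + 3 * p x)) = 0.

End RaychaudhuriEhlers.

End Spacetime.

(* Main.v *)
Require Import Defs.
From HB Require Import structures.
From mathcomp Require Import all_boot all_order all_algebra.
From mathcomp Require Import all_classical all_reals all_analysis.
From mathcomp Require Import ring.
Import Order.TTheory GRing.Theory Num.Theory.
Import numFieldNormedType.Exports.
Local Open Scope classical_set_scope.
Local Open Scope ring_scope.

(** Write the metric as [- N dtau^2 + S (dx1^2 + dx2^2 + dx3^2)], with
    [N = a^2 (1 + 2 A)] and [S = a^2 (1 - 2 A)].  The natural unknowns are not
    [N] and [S] but the gradients [u] of [log N / 2] and [v] of [log S / 2]:
    the Christoffel symbols are linear in [u] and [v], up to the ratio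
    [q = N / S], whose logarithmic derivative is [2 (u - v)].  Hence the Ricci
    and Einstein tensors are polynomials in [u], [v], their first derivatives,
    [q] and [q^-1].  In particular, with [dv], [du] the Hessians,
    - [G_00 = 3 v_0^2 - q sum_k (2 dv_kk + v_k^2)],
    - [G_i0 = - 2 (dv_i0 - u_i v_0)],
    - for [i <> j], [G_ij = - (du_ij + dv_ij) - u_i u_j + u_i v_j + u_j v_i
      + v_i v_j], with an isotropic term added on the diagonal.

    Since [log N / 2 = log a + log (1 + 2 A) / 2] and similarly for [S], one
    has [u_0 = H + A' / (1 + 2 A)], [v_0 = H - A' / (1 - 2 A)],
    [u_i = A_i / (1 + 2 A)] and [v_i = - A_i / (1 - 2 A)]; substituting these
    and clearing denominators gives the three field equations
    ([einstein_tensor_space], [einstein_tensor_mixed],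
    [einstein_tensor_time]).  The mixed component comes out multiplied by
    [2 / ((1 - 2 A)^2 (1 + 2 A))], which is positive.

    The definition of the Ricci tensor takes second derivatives of the metric
    in different orders in different places, so the symmetry of second
    derivatives ([derive_comm]) is essential, both for the closed forms above
    and for the symmetry of [G], by which the [0i] equations follow from the
    [i0] ones.

    The kinematic quantities live in the same unknowns: the expansion is
    [3 v_0], the shear vanishes because [Theta_ij] is proportional to the
    spatial metric, [Psi = u_0] and [b_i = u_i].  On a slice, [log sqrt(det)] is
    [3 log S / 2], so [b^2 + div b] is
    [S^-1 sum_k (du_kk + u_k^2 + u_k v_k)]; this turns the Raychaudhuri-Ehlers
    equation into [raychaudhuri_flrw], and the same substitution finishes. *)

(** * Directional derivatives along lines and their symmetry *)

Section Lines.
Set Implicit Arguments.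
Unset Strict Implicit.
Variables (R : realType) (V : normedModType R).
Implicit Types (f : V -> R) (u v x : V).

(** A directional derivative is an ordinary derivative along a line; this
    makes the one-variable theorems (mean value, chain rule) available. *)
Lemma is_derive_lineP f v x (t d : R) :
  is_derive (t *: v + x) v f d <-> is_derive t 1 (fun s => f (s *: v + x)) d.
Proof.
have E : (fun h : R => h^-1 *: (f ((h *: 1 + t) *: v + x) - f (t *: v + x))) =
         (fun h : R => h^-1 *: (f (h *: v + (t *: v + x)) - f (t *: v + x))).
  by apply/funext => h; rewrite scaler1 scalerDl addrA.
split=> -[df <-].
  by apply: DeriveDef; [rewrite /derivable /= E|rewrite /derive /= E].
apply: DeriveDef; first by move: df; rewrite /derivable /= E.
by rewrite /derive /= E.
Qed.

Lemma MVT_line f v x (h : R) : 0 < h ->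
  (forall t, 0 <= t <= h -> derivable f (t *: v + x) v) ->
  exists2 t, 0 < t < h & f (h *: v + x) - f x = h * 'D_v f (t *: v + x).
Proof.
move=> h0 df.
have dF t : t \in `[0, h]%R ->
    is_derive t 1 (fun s => f (s *: v + x)) ('D_v f (t *: v + x)).
  by rewrite in_itv /= => tI; apply/is_derive_lineP/derivableP/df.
have cF : {within `[0, h], continuous (fun s => f (s *: v + x))}.
  by apply: derivable_within_continuous => t /dF [].
have dF' t : t \in `]0, h[%R ->
    is_derive t 1 (fun s => f (s *: v + x)) ('D_v f (t *: v + x)).
  by move=> tI; apply: dF; apply: subset_itv_oo_cc.
have [t] := MVT h0 dF' cF.
rewrite in_itv /= scale0r add0r subr0 mulrC => tI E.
by exists t.
Qed.

(** The mean value theorem applied twice, first along [u] to the difference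
    of [f] in the direction [v], then along [v] to ['D_u f]: the second
    difference of [f] on a small parallelogram, which is symmetric in [u] and
    [v], is [h ^+ 2] times a value of the mixed derivative nearby. *)
Lemma second_difference f u v x (h : R) : 0 < h ->
  (forall s t, 0 <= s <= h -> 0 <= t <= h ->
    derivable f (s *: u + (t *: v + x)) u /\
    derivable ('D_u f) (s *: u + (t *: v + x)) v) ->
  exists s t, [/\ 0 < s < h, 0 < t < h &
    f (h *: u + (h *: v + x)) - f (h *: u + x) - (f (h *: v + x) - f x)
    = h * (h * 'D_v ('D_u f) (s *: u + (t *: v + x)))].
Proof.
move=> h0 df.
have hh : 0 <= h <= h by rewrite lexx ltW.
have zh : 0 <= (0 : R) <= h by rewrite lexx ltW.
pose F y := f (h *: v + y) - f y.
have dF s : 0 <= s <= h -> is_derive (s *: u + x) u F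
   ('D_u f (s *: u + (h *: v + x)) - 'D_u f (s *: u + x)).
  move=> sI.
  have [d1 _] := df s h sI hh; have [d2 _] := df s 0 sI zh.
  move: d2; rewrite scale0r add0r => d2.
  apply: is_deriveB; last exact: derivableP.
  have E : (fun h0 => h0^-1 *: (f (h *: v + (h0 *: u + (s *: u + x))) -
                               f (h *: v + (s *: u + x)))) =
           (fun h0 => h0^-1 *: (f (h0 *: u + (s *: u + (h *: v + x))) -
                               f (s *: u + (h *: v + x)))).
    apply/funext => k; congr (_ *: (f _ - f _)).
      by rewrite [RHS]addrA [RHS]addrCA -!addrA.
    by rewrite addrCA.
  apply: DeriveDef; first by rewrite /derivable /= E.
  by rewrite /derive /= E.
have [|s sI] := @MVT_line F u x h h0; first by move=> s /dF[].
have sI' : 0 <= s <= h by case/andP: sI => *; rewrite !ltW.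
rewrite (@derive_val _ _ _ _ _ _ _ (dF s sI')).
have [|t tI E1 E2] := @MVT_line ('D_u f) v (s *: u + x) h h0.
  by move=> t tI; rewrite addrCA; have [] := df s t sI' tI.
exists s, t; split => //.
rewrite [s *: u + (t *: v + x)]addrCA -E1.
rewrite [h *: v + (s *: u + x)]addrCA -E2 /F.
by rewrite [h *: u + (h *: v + x)]addrCA.
Qed.

(** Symmetry of continuous mixed derivatives.  The same second difference is
    evaluated in both orders; as the parallelogram shrinks, the two values
    of the mixed derivatives converge to those at [x]. *)
Lemma derive_comm f u v x :
  (\forall y \near x, derivable f y u /\ derivable f y v) ->
  (\forall y \near x, derivable ('D_u f) y v /\ derivable ('D_v f) y u) ->
  {for x, continuous ('D_v ('D_u f))} ->
  {for x, continuous ('D_u ('D_v f))} ->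
  'D_v ('D_u f) x = 'D_u ('D_v f) x.
Proof.
move=> df ddf cuv cvu; apply/eqP; rewrite -subr_eq0 -normr_le0.
apply/ler_addgt0Pr => e e0; rewrite add0r.
have e2 : 0 < e / 2 by rewrite divr_gt0.
have n1 : \forall y \near x, `|'D_v ('D_u f) x - 'D_v ('D_u f) y| < e / 2.
  by move/cvgrPdist_lt: cuv; apply.
have n2 : \forall y \near x, `|'D_u ('D_v f) x - 'D_u ('D_v f) y| < e / 2.
  by move/cvgrPdist_lt: cvu; apply.
have nx : nbhs x [set y |
    ((derivable f y u /\ derivable f y v) /\
     (derivable ('D_u f) y v /\ derivable ('D_v f) y u)) /\
    (`|'D_v ('D_u f) x - 'D_v ('D_u f) y| < e / 2 /\
     `|'D_u ('D_v f) x - 'D_u ('D_v f) y| < e / 2)].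
  exact: (filterI (filterI df ddf) (filterI n1 n2)).
have [r /= r0 near_x] := (nbhs_ballP _ _).1 nx.
(* This side length keeps the whole parallelogram in the ball; the [+ 1]
   covers the case [u = v = 0]. *)
pose h := r / (2 * (`|u| + `|v| + 1)).
have d0 : 0 < `|u| + `|v| + 1 by rewrite ltr_wpDl // addr_ge0.
have h0 : 0 < h by rewrite divr_gt0 // mulr_gt0.
have inb s t : 0 <= s <= h -> 0 <= t <= h -> ball x r (s *: u + (t *: v + x)).
  move=> /andP[s0 sh] /andP[t0 th]; rewrite -ball_normE /= addrA distrC addrK.
  apply: (le_lt_trans (ler_normD _ _)); rewrite !normrZ !ger0_norm //.
  have hr : h * (`|u| + `|v| + 1) = r / 2.
    by rewrite /h invfM mulrA mulfVK // gt_eqF.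
  apply: (@le_lt_trans _ _ (h * (`|u| + `|v| + 1))); last first.
    by rewrite hr ltr_pdivrMr // ltr_pMr // ltr1n.
  rewrite !mulrDr mulr1; apply: ler_wpDr; first exact: ltW.
  by apply: lerD; exact: ler_wpM2r.
have [s [t [/andP[s0 sh] /andP[t0 th] E1]]] := @second_difference f u v x h h0
  (fun s t sI tI => let: conj (conj (conj a _) (conj b _)) _ := near_x _ (inb s t sI tI)
                    in conj a b).
have inb' s' t' : 0 <= s' <= h -> 0 <= t' <= h -> ball x r (s' *: v + (t' *: u + x)).
  by move=> *; rewrite addrCA; exact: inb.
have [s' [t' [/andP[s'0 s'h] /andP[t'0 t'h] E2]]] := @second_difference f v u x h h0
  (fun s t sI tI => let: conj (conj (conj _ a) (conj _ b)) _ := near_x _ (inb' s t sI tI)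
                    in conj a b).
have hs : 0 <= s <= h by rewrite !ltW.
have ht : 0 <= t <= h by rewrite !ltW.
have hs' : 0 <= s' <= h by rewrite !ltW.
have ht' : 0 <= t' <= h by rewrite !ltW.
have [_ [N1 _]] := near_x _ (inb s t hs ht).
have [_ [_ N2]] := near_x _ (inb' s' t' hs' ht').
have E : 'D_v ('D_u f) (s *: u + (t *: v + x)) = 'D_u ('D_v f) (s' *: v + (t' *: u + x)).
  have hn : h != 0 by rewrite gt_eqF.
  have : forall a b c d e c' : R, a - b - (c - d) = h * (h * e) ->
      a - c - (b - d) = h * (h * c') -> e = c'.
    move=> a0 b0 c0 d' e1 e3 H1 H2; apply: (mulfI hn); apply: (mulfI hn).
    by rewrite -H1 -H2; ring.
  by apply; [exact: E1|rewrite addrCA; exact: E2].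
have dist (a b c : R) : `|a - c| < e / 2 -> `|b - c| < e / 2 -> `|a - b| <= e.
  rewrite (distrC b) => ac cb; rewrite (splitr e); apply: ltW.
  exact: le_lt_trans (ler_distD c a b) (ltrD ac cb).
by rewrite E in N1; exact: dist N1 N2.
Qed.

Lemma is_derive_sqrt_comp f x v (df : R) : 0 < f x -> is_derive x v f df ->
  is_derive x v (fun y => Num.sqrt (f y)) (df / (2 * Num.sqrt (f x))).
Proof.
move=> f0 dfx; have x0 : x = 0 *: v + x by rewrite scale0r add0r.
have f0' : 0 < f (0 *: v + x) by rewrite -x0.
rewrite [X in is_derive X]x0 in dfx; move/is_derive_lineP: dfx => dfx.
have := is_derive1_comp (is_derive1_sqrt f0') dfx.
by move/(@is_derive_lineP (fun y => Num.sqrt (f y))); rewrite -x0 mulrC.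
Qed.
End Lines.

(** * Ricci and Einstein tensors in logarithmic derivatives *)

(** The indices are kept in the form in which [big_ord_recl] produces them, so
    that [ring] identifies the resulting atoms. *)
Lemma ord3P (P : 'I_3 -> Prop) : P ord0 -> P (lift ord0 ord0) ->
  P (lift ord0 (lift ord0 ord0)) -> forall i, P i.
Proof.
move=> P0 P1 P2 [[|[|[|//]]] i3].
- by rewrite (_ : Ordinal i3 = ord0) //; apply/val_inj.
- by rewrite (_ : Ordinal i3 = lift ord0 ord0) //; apply/val_inj.
- by rewrite (_ : Ordinal i3 = lift ord0 (lift ord0 ord0)) //; apply/val_inj.
Qed.

Section DiagonalConnection.
Set Implicit Arguments.
Unset Strict Implicit.
Variables (R : realType) (n : nat).
Variables (l : 'I_n -> 'I_n -> R) (L : 'I_n -> 'I_n -> 'I_n -> R) (r : 'I_n -> 'I_n -> R).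

(** The symbol [Gamma^k_ij] of the metric [diag (g_i)], where [l i k] is
    half the derivative of [log |g_i|] in direction [k], and [r i k] is
    [g_i / g_k]. *)
Definition diag_chr k i j : R :=
  (j == k)%:R * l k i + (i == k)%:R * l k j - (i == j)%:R * (r i k * l i k).

(** The derivative of [diag_chr] in direction [m], with [L i k m] the
    derivative of [l i k]; the ratio [r i k] has logarithmic derivative
    [2 * (l i m - l k m)]. *)
Definition diag_dchr m k i j : R :=
  (j == k)%:R * L k i m + (i == k)%:R * L k j m
  - (i == j)%:R * (r i k * (2 * (l i m - l k m) * l i k + L i k m)).

Definition diag_ricci i j : R :=
  \sum_k (diag_dchr k k j i - diag_dchr j k k i
    + \sum_m (diag_chr k k m * diag_chr m j i - diag_chr k j m * diag_chr m k i)).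
End DiagonalConnection.

(** The functions [u] and [v] stand for the gradients of [log N / 2] and
    [log S / 2] for the metric [- N dt^2 + S (dx^2 + dy^2 + dz^2)], [U] and
    [V] for the Hessians, and [q] for [N / S], with inverse [w].  In these
    unknowns the Ricci tensor is a polynomial, so that the formulas below
    are ring identities once the finite sums are written out. *)
Section IsotropicRicci.
Set Implicit Arguments.
Unset Strict Implicit.
Variable R : realType.
Variables (q w : R) (u v : 'I_4 -> R) (U V : 'I_4 -> 'I_4 -> R).
Hypothesis qw : q * w = 1.
Hypothesis UC : forall i j, U i j = U j i.
Hypothesis VC : forall i j, V i j = V j i.

Let l (i : 'I_4) := if i == ord0 then u else v.
Let L (i : 'I_4) := if i == ord0 then U else V.
Let r (i k : 'I_4) : R := if i == ord0 then if k == ord0 then 1 else - q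
                          else if k == ord0 then - w else 1.

Lemma isotropic_ricci00 : diag_ricci l L r ord0 ord0 =
  - 3 * (V ord0 ord0 + v ord0 ^+ 2 - u ord0 * v ord0)
  + q * (\sum_k (U (sp k) (sp k) + u (sp k) ^+ 2 + u (sp k) * v (sp k))).
Proof.
rewrite /diag_ricci /diag_chr /diag_dchr !big_ord_recl !big_ord0 /= /l /L /r /= /sp.
by ring.
Qed.

Lemma isotropic_ricci0s i : diag_ricci l L r ord0 (sp i) =
  - 2 * (V ord0 (sp i) - u (sp i) * v ord0).
Proof.
move: i; apply: ord3P;
  rewrite /diag_ricci /diag_chr /diag_dchr !big_ord_recl !big_ord0 /= /l /L /r /= /sp
    ?[V (lift _ _) ord0]VC ?[U (lift _ _) ord0]UC.
all: by ring: qw.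
Qed.

Lemma isotropic_riccis0 i : diag_ricci l L r (sp i) ord0 =
  - 2 * (V ord0 (sp i) - u (sp i) * v ord0).
Proof.
move: i; apply: ord3P;
  rewrite /diag_ricci /diag_chr /diag_dchr !big_ord_recl !big_ord0 /= /l /L /r /= /sp
    ?[V (lift _ _) ord0]VC ?[U (lift _ _) ord0]UC.
all: by ring: qw.
Qed.

Lemma isotropic_ricciss i j : diag_ricci l L r (sp i) (sp j) =
  - (U (sp i) (sp j) + V (sp i) (sp j)) - u (sp i) * u (sp j)
  + u (sp i) * v (sp j) + u (sp j) * v (sp i) + v (sp i) * v (sp j)
  + (i == j)%:R * (w * (V ord0 ord0 + 3 * v ord0 ^+ 2 - u ord0 * v ord0)
    - \sum_k (V (sp k) (sp k) + v (sp k) ^+ 2 + u (sp k) * v (sp k))).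
Proof.
move: i j; apply: ord3P; apply: ord3P;
  rewrite /diag_ricci /diag_chr /diag_dchr !big_ord_recl !big_ord0 /= /l /L /r /= /sp.
all: rewrite ?[V (lift ord0 (lift ord0 (lift ord0 ord0))) (lift ord0 (lift ord0 ord0))]VC
  ?[U (lift ord0 (lift ord0 (lift ord0 ord0))) (lift ord0 (lift ord0 ord0))]UC
  ?[V (lift ord0 (lift ord0 _)) (lift ord0 ord0)]VC ?[U (lift ord0 (lift ord0 _)) (lift ord0 ord0)]UC.
all: by ring.
Qed.
End IsotropicRicci.

(** [ric] is the Ricci tensor, as above, and [scal] its trace with respect to
    [diag (- N, S, S, S)]; the trace is where the factors [N] and [S] enter
    otherwise than through their ratio, and they recombine into [q]. *)
Section IsotropicEinstein.
Set Implicit Arguments.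
Unset Strict Implicit.
Variable R : realType.
Variables (N S : R) (u v : 'I_4 -> R) (U V : 'I_4 -> 'I_4 -> R).
Hypothesis N0 : N != 0.
Hypothesis S0 : S != 0.
Hypothesis UC : forall i j, U i j = U j i.
Hypothesis VC : forall i j, V i j = V j i.

Let q := N / S.
Let ric := diag_ricci (fun i => if i == ord0 then u else v)
  (fun i => if i == ord0 then U else V)
  (fun i k => if i == ord0 then if k == ord0 then 1 else - q
              else if k == ord0 then - q^-1 else 1).
Let scal := - N^-1 * ric ord0 ord0 + S^-1 * \sum_k ric (sp k) (sp k).

Lemma isotropic_einstein00 : ric ord0 ord0 - 2^-1 * scal * - N =
  3 * v ord0 ^+ 2 - q * \sum_k (2 * V (sp k) (sp k) + v (sp k) ^+ 2).
Proof.
rewrite /scal /ric.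
under eq_bigr do rewrite (isotropic_ricciss q q^-1 u v UC VC) eqxx mulr1n mul1r.
rewrite (isotropic_ricci00 q q^-1 u v U V) !big_ord_recl !big_ord0 /q.
by field; rewrite N0 S0.
Qed.

Lemma isotropic_einsteinss i j :
  ric (sp i) (sp j) - 2^-1 * scal * ((i == j)%:R * S) =
  - (U (sp i) (sp j) + V (sp i) (sp j)) - u (sp i) * u (sp j)
  + u (sp i) * v (sp j) + u (sp j) * v (sp i) + v (sp i) * v (sp j)
  + (i == j)%:R * (q^-1 * (2 * u ord0 * v ord0 - 2 * V ord0 ord0 - 3 * v ord0 ^+ 2)
    + \sum_k (U (sp k) (sp k) + u (sp k) ^+ 2 + V (sp k) (sp k))).
Proof.
rewrite /scal /ric.
under eq_bigr do rewrite (isotropic_ricciss q q^-1 u v UC VC) eqxx mulr1n mul1r.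
rewrite (isotropic_ricciss q q^-1 u v UC VC) (isotropic_ricci00 q q^-1 u v U V).
rewrite !big_ord_recl !big_ord0 /q.
by field; rewrite N0 S0.
Qed.
End IsotropicEinstein.

(** * Connection and curvature of a diagonal metric *)

Section DiagonalMetric.
Set Implicit Arguments.
Unset Strict Implicit.
Variables (R : realType) (n : nat).
Implicit Types (f : 'rV[R]_n -> R) (i j k m : 'I_n) (x y : 'rV[R]_n).

Definition half_dlog i f x : R := partial i f x / (2 * f x).

Lemma invmx_diag_mx (d : 'rV[R]_n) : (forall i, d 0 i != 0) ->
  invmx (diag_mx d) = diag_mx (\row_i (d 0 i)^-1).
Proof.
move=> d0; have d_unit : diag_mx d \in unitmx.
  by rewrite unitmxE det_diag unitfE; apply/prodf_neq0.
rewrite -[RHS]mul1mx -(mulVmx d_unit) -mulmxA mulmx_diag.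
rewrite (_ : (\row_j _) = const_mx 1) ?diag_const_mx ?mulmx1 //.
by apply/rowP => i; rewrite !mxE mulfV.
Qed.

Variable g : 'I_n -> 'rV[R]_n -> R.
Let gm := fun y => diag_mx (\row_i g i y).

Lemma partial_diag_entry m i j y :
  partial m (fun z => gm z i j) y = (i == j)%:R * partial m (g i) y.
Proof.
case: eqP => [->|/eqP/negPf ij].
  rewrite mul1r; congr (partial m _ y); apply/funext => z.
  by rewrite /gm !mxE eqxx.
rewrite mul0r (_ : (fun z => gm z i j) = cst 0); first exact: derive_cst.
by apply/funext => z; rewrite /gm !mxE ij.
Qed.

(** For a diagonal metric the three derivatives in a Christoffel symbol
    survive only on coinciding indices. *)
Lemma christoffel_diag k i j y : (forall i, g i y != 0) ->
  christoffel gm k i j y =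
  diag_chr (fun i k => half_dlog k (g i) y) (fun i k => g i y / g k y) k i j.
Proof.
move=> g0; rewrite /christoffel (bigD1 k) //= big1 ?addr0; last first.
  move=> m mk; rewrite /gm invmx_diag_mx; last by move=> ?; rewrite !mxE.
  by rewrite !mxE eq_sym (negPf mk) mul0r.
rewrite !partial_diag_entry /gm invmx_diag_mx; last by move=> ?; rewrite !mxE.
rewrite !mxE eqxx mulr1n /diag_chr /half_dlog.
have [gi0 gk0] := (g0 i, g0 k).
case: (eqVneq j k) => [->|jk]; case: (eqVneq i k) => [->|ik];
  rewrite ?eqxx ?[k == j]eq_sym ?(negPf ik) ?(negPf jk) /= ?mulr1n ?mulr0n ?mul0r.
- by field.
- by field; rewrite ?gk0 ?gi0.
- by field.
- by field; rewrite gi0 gk0.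
Qed.


Lemma is_derive_ratio f (h : 'rV[R]_n -> R) x m : f x != 0 -> h x != 0 ->
  derivable f x (delta_mx 0 m) -> derivable h x (delta_mx 0 m) ->
  is_derive x (delta_mx 0 m) (fun y => f y / h y)
    (f x / h x * (2 * (half_dlog m f x - half_dlog m h x))).
Proof.
move=> f0 h0 df dh.
have dhV : is_derive x (delta_mx 0 m) (fun y => (h y)^-1)
    (- (h x) ^- 2 *: partial m h x).
  by apply: DeriveDef; [exact: derivableV | exact: deriveV].
have dM := is_deriveM (derivableP df) dhV.
apply: is_derive_eq; rewrite /half_dlog -/(partial m f x) /GRing.scale /=.
by field; rewrite f0 h0.
Qed.

(** The Christoffel symbols are differentiated at [x], so their closed form is
    needed in a neighbourhood of [x]. *)
Variables (x : 'rV[R]_n) (L : 'I_n -> 'I_n -> 'I_n -> R).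
Hypothesis g_neq0 : \forall y \near x, forall i, g i y != 0.
Hypothesis dg : forall i m, derivable (g i) x (delta_mx 0 m).
Hypothesis dlg : forall i k m,
  is_derive x (delta_mx 0 m) (half_dlog k (g i)) (L i k m).

Lemma partial_christoffel_diag m k i j :
  partial m (christoffel gm k i j) x =
  diag_dchr (fun i k => half_dlog k (g i) x) L (fun i k => g i x / g k x) m k i j.
Proof.
have g0 : forall i, g i x != 0 := nbhs_singleton g_neq0.
transitivity (partial m (fun y => (j == k)%:R * half_dlog i (g k) y
    + (i == k)%:R * half_dlog j (g k) y
    - (i == j)%:R * (g i y / g k y * half_dlog k (g i) y)) x).
  apply: near_eq_derive; apply: filterS g_neq0 => y gy.
  exact: christoffel_diag.
have dr := is_derive_ratio (g0 i) (g0 k) (@dg i m) (@dg k m).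
have dM := is_deriveM dr (@dlg i k m).
have dZ := fun (c : bool) f df (F : is_derive x (delta_mx 0 m) f df) =>
  is_deriveZ (c%:R : R) F.
have := is_deriveB (is_deriveD (dZ (j == k) _ _ (@dlg k i m)) (dZ (i == k) _ _ (@dlg k j m)))
  (dZ (i == j) _ _ dM).
move=> /(@derive_val _ _ _ _ _ _ _); rewrite /partial => ->.
by rewrite /diag_dchr /GRing.scale /=; ring.
Qed.

Lemma ricci_diag i j : ricci gm x i j =
  diag_ricci (fun i k => half_dlog k (g i) x) L (fun i k => g i x / g k x) i j.
Proof.
have g0 : forall i, g i x != 0 := nbhs_singleton g_neq0.
rewrite /ricci mxE; apply: eq_bigr => k _; rewrite /riemann.
rewrite !partial_christoffel_diag; congr (_ + _).
by apply: eq_bigr => m _; rewrite !christoffel_diag.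
Qed.

End DiagonalMetric.

(** * The chart: time, slices and the metric coefficients *)

Section ChartCalculus.
Set Implicit Arguments.
Unset Strict Implicit.
Variable R : realType.
Implicit Types (x y : 'rV[R]_4) (f : R -> R) (m : 'I_4).

Lemma sp_neq0 (i : 'I_3) : (sp i == ord0) = false.
Proof. by []. Qed.

Lemma eq_sp (i j : 'I_3) : (sp i == sp j) = (i == j).
Proof. exact: (inj_eq lift_inj). Qed.

Lemma time_shift (h : R) x m :
  time (h *: delta_mx 0 m + x) = h * (m == ord0)%:R + time x.
Proof. by rewrite /time !mxE eqxx /= [_ == m]eq_sym. Qed.

Lemma is_derive_time f x m : derivable f (time x) 1 ->
  is_derive x (delta_mx 0 m) (fun y => f (time y))
    ((m == ord0)%:R * derive1 f (time x)).
Proof.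
move=> df.
have E : (fun h : R => h^-1 *: (f (time (h *: delta_mx 0 m + x)) - f (time x))) =
         (fun h : R => h^-1 *: (f (h * (m == ord0)%:R + time x) - f (time x))).
  by apply/funext => h; rewrite time_shift.
case: (eqVneq m ord0) => m0 in E *.
  rewrite mul1r derive1E.
  by apply: DeriveDef; [rewrite /derivable /= E|rewrite /derive /= E].
rewrite mul0r.
have E0 : (fun h : R => h^-1 *: (f (time (h *: delta_mx 0 m + x)) - f (time x))) = cst 0.
  by rewrite E; apply/funext => h; rewrite mulr0 add0r subrr scaler0.
apply: DeriveDef; first by rewrite /derivable /= E0; exact: is_cvg_cst.
by rewrite /derive /= E0; exact: lim_cst.
Qed.

Lemma event_sp (t : R) (y : 'rV[R]_3) i : event t y 0 (sp i) = y 0 i.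
Proof.
rewrite (_ : sp i = rshift 1 i); last exact/val_inj.
exact: row_mxEr.
Qed.

Lemma event_ord0 (t : R) (y : 'rV[R]_3) : event t y 0 ord0 = t.
Proof.
rewrite (_ : ord0 = lshift 3 (ord0 : 'I_1)); last exact/val_inj.
by rewrite [LHS]row_mxEl mxE.
Qed.

Lemma event_shift (h : R) (k : 'I_3) x :
  event (time x) (h *: delta_mx 0 k + position x) = h *: delta_mx 0 (sp k) + x.
Proof.
apply/rowP => i; case: (unliftP ord0 i) => [j ->|->].
  by rewrite -/(sp j) event_sp !mxE eq_sp.
by rewrite event_ord0 !mxE mulr0 add0r.
Qed.

Lemma event_time_position x : event (time x) (position x) = x.
Proof.
by have := event_shift 0 ord0 x; rewrite ![_ *: delta_mx _ _]scale0r ![0 + _]add0r.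
Qed.

(** A slice [tau = const] is an affine subspace, so differentiating along it
    is differentiating in spacetime. *)
Lemma partial_slice (f : 'rV[R]_4 -> R) (k : 'I_3) x :
  partial k (fun z => f (event (time x) z)) (position x) = partial (sp k) f x.
Proof.
rewrite /partial /derive /=; congr (lim _).
rewrite (_ : (fun h => _) = (fun h : R =>
  h^-1 *: ((f \o shift x) (h *: delta_mx 0 (sp k)) - f x))) //.
by apply/funext => h /=; rewrite event_shift event_time_position.
Qed.

End ChartCalculus.

Section ScaleFactors.
Set Implicit Arguments.
Unset Strict Implicit.
Variables (R : realType) (M : set 'rV[R]_4) (a : R -> R) (A : 'rV[R]_4 -> R).
Hypothesis M_open : open M.
Hypothesis a_smooth : forall (k : nat) (x : 'rV[R]_4), M x ->
  derivable (derive1n k a) (time x) 1.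
Hypothesis a_gt0 : forall x : 'rV[R]_4, M x -> 0 < a (time x).
Hypothesis A_smooth : smooth_on M A.
Implicit Types (x y : 'rV[R]_4) (m k : 'I_4) (s : R).

Lemma near_chart x (P : 'rV[R]_4 -> Prop) :
  (forall y, M y -> P y) -> M x -> \forall y \near x, P y.
Proof.
by move=> MP Mx; apply: filterS MP _; apply: open_nbhs_nbhs; split.
Qed.

Lemma partialC m k x : M x -> partial m (partial k A) x = partial k (partial m A) x.
Proof.
move=> Mx; apply: derive_comm.
- by apply: near_chart Mx => y My; split; have [_] := A_smooth [::] My; apply.
- apply: near_chart Mx => y My; split.
    by have [_] := A_smooth [:: k] My; apply.
  by have [_] := A_smooth [:: m] My; apply.
- by have [] := A_smooth [:: m; k] Mx.
- by have [] := A_smooth [:: k; m] Mx.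
Qed.

(** The metric coefficients are [- scale_fun 1] (for [dtau^2]) and
    [scale_fun (-1)] (for each [dxi^2]), so that one computation covers both. *)
Definition scale_fun s y : R := a (time y) ^+ 2 * (1 + 2 * s * A y).

(** The gradient and the Hessian of [log (scale_fun s) / 2]. *)
Definition dlog_scale s m x : R :=
  (m == ord0)%:R * hubble a (time x) + s * partial m A x / (1 + 2 * s * A x).

Definition ddlog_scale s m k x : R :=
  (m == ord0)%:R * ((k == ord0)%:R * derive1 (hubble a) (time x))
  + (s * partial k (partial m A) x / (1 + 2 * s * A x)
     - 2 * s ^+ 2 * partial m A x * partial k A x / (1 + 2 * s * A x) ^+ 2).

Lemma ddlog_scaleC s m k x : M x -> ddlog_scale s m k x = ddlog_scale s k m x.
Proof. by move=> Mx; rewrite /ddlog_scale partialC //; ring. Qed.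

Lemma is_derive_A x m : M x -> is_derive x (delta_mx 0 m) A (partial m A x).
Proof. by move=> Mx; apply: derivableP; have [_] := A_smooth [::] Mx; apply. Qed.

Lemma is_derive_dA x m k : M x ->
  is_derive x (delta_mx 0 k) (partial m A) (partial k (partial m A) x).
Proof. by move=> Mx; apply: derivableP; have [_] := A_smooth [:: m] Mx; apply. Qed.

Lemma is_derive_weight s x m : M x ->
  is_derive x (delta_mx 0 m) (fun y => 1 + 2 * s * A y) (2 * s * partial m A x).
Proof.
move=> Mx.
have c1 : is_derive x (delta_mx 0 m) (cst (1 : R)) 0 by exact: is_derive_cst.
have := is_deriveD c1 (is_deriveZ (2 * s) (is_derive_A m Mx)).
by rewrite add0r.
Qed.

Lemma is_derive_scale s x m : M x -> 1 + 2 * s * A x != 0 ->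
  is_derive x (delta_mx 0 m) (scale_fun s) (2 * scale_fun s x * dlog_scale s m x).
Proof.
move=> Mx w0.
have da := is_derive_time m (@a_smooth 0%N _ Mx : derivable a _ _).
have := is_deriveM (is_deriveX 2 da) (is_derive_weight s m Mx).
move=> /is_derive_eq; apply; rewrite /GRing.scale /= exprfctE /scale_fun /dlog_scale /hubble expr1.
have : a (time x) != 0 by rewrite gt_eqF ?a_gt0.
by move=> a0; field; rewrite w0 a0.
Qed.

Lemma half_dlog_scale s x m : M x -> 1 + 2 * s * A x != 0 ->
  half_dlog m (scale_fun s) x = dlog_scale s m x.
Proof.
move=> Mx w0; rewrite /half_dlog /partial.
rewrite (@derive_val _ _ _ _ _ _ _ (is_derive_scale m Mx w0)).
have : a (time x) != 0 by rewrite gt_eqF ?a_gt0.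
by rewrite /scale_fun => a0; field; rewrite w0 a0.
Qed.

Lemma is_derive_hubble x k : M x -> is_derive x (delta_mx 0 k)
  (fun y => hubble a (time y)) ((k == ord0)%:R * derive1 (hubble a) (time x)).
Proof.
move=> Mx; apply: is_derive_time.
have d0 : derivable a (time x) 1 := @a_smooth 0%N _ Mx.
have d1 : derivable (derive1 a) (time x) 1 := @a_smooth 1%N _ Mx.
have a0 : a (time x) != 0 by rewrite gt_eqF ?a_gt0.
exact: derivableM d1 (derivableV a0 d0).
Qed.

Lemma is_derive_dlog_scale s x m k : M x -> 1 + 2 * s * A x != 0 ->
  is_derive x (delta_mx 0 k) (dlog_scale s m) (ddlog_scale s m k x).
Proof.
move=> Mx w0.
have wV : is_derive x (delta_mx 0 k) (fun y => (1 + 2 * s * A y)^-1)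
    (- (1 + 2 * s * A x) ^- 2 *: (2 * s * partial k A x)).
  have [dw <-] := is_derive_weight s k Mx.
  by apply: DeriveDef; [exact: derivableV | exact: deriveV].
have dZ : is_derive x (delta_mx 0 k) (fun y => s * partial m A y)
    (s * partial k (partial m A) x) := is_deriveZ s (is_derive_dA m k Mx).
have := is_deriveD (is_deriveZ ((m == ord0)%:R : R) (is_derive_hubble k Mx))
  (is_deriveM dZ wV).
move=> /is_derive_eq; apply; rewrite /GRing.scale /= /ddlog_scale.
by field.
Qed.

End ScaleFactors.

Section LogDerivatives.
Set Implicit Arguments.
Unset Strict Implicit.
Variables (R : realType) (a : R -> R) (A : 'rV[R]_4 -> R) (x : 'rV[R]_4).
Hypothesis dm : 1 - 2 * A x != 0.

Lemma dlog_lapse_tau : dlog_scale a A 1 ord0 x =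
  hubble a (time x) + d_tau A x / (1 + 2 * A x).
Proof. by rewrite /dlog_scale eqxx mulr1n !mul1r mulr1. Qed.

Lemma dlog_space_tau : dlog_scale a A (-1) ord0 x =
  hubble a (time x) - d_tau A x / (1 - 2 * A x).
Proof. by rewrite /dlog_scale eqxx mulr1n mul1r mulN1r mulrN1 !mulNr. Qed.

Lemma dlog_lapse_sp i : dlog_scale a A 1 (sp i) x = d_sp i A x / (1 + 2 * A x).
Proof. by rewrite /dlog_scale sp_neq0 mulr0n mul0r add0r mul1r mulr1. Qed.

Lemma dlog_space_sp i : dlog_scale a A (-1) (sp i) x = - (d_sp i A x / (1 - 2 * A x)).
Proof. by rewrite /dlog_scale sp_neq0 mulr0n mul0r add0r mulN1r mulrN1 !mulNr. Qed.

Lemma ddlog_space_tau : ddlog_scale a A (-1) ord0 ord0 x =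
  derive1 (hubble a) (time x) - d_tau (d_tau A) x / (1 - 2 * A x)
  - 2 * d_tau A x ^+ 2 / (1 - 2 * A x) ^+ 2.
Proof.
rewrite /ddlog_scale eqxx mulr1n !mul1r mulrN1 mulNr -!/(d_tau _).
by field.
Qed.

Lemma ddlog_lapse_sp i j : ddlog_scale a A 1 (sp i) (sp j) x =
  d_sp j (d_sp i A) x / (1 + 2 * A x)
  - 2 * d_sp i A x * d_sp j A x / (1 + 2 * A x) ^+ 2.
Proof.
by rewrite /ddlog_scale sp_neq0 mulr0n mul0r add0r mulr1 mul1r expr1n mulr1.
Qed.

Lemma ddlog_space_sp i j : ddlog_scale a A (-1) (sp i) (sp j) x =
  - (d_sp j (d_sp i A) x / (1 - 2 * A x))
  - 2 * d_sp i A x * d_sp j A x / (1 - 2 * A x) ^+ 2.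
Proof.
by rewrite /ddlog_scale sp_neq0 mulr0n mul0r add0r mulrN1 !mulN1r !mulNr sqrrN expr1n mulr1.
Qed.

Lemma ddlog_space_sp_tau i : ddlog_scale a A (-1) (sp i) ord0 x =
  - (d_tau (d_sp i A) x / (1 - 2 * A x))
  - 2 * d_sp i A x * d_tau A x / (1 - 2 * A x) ^+ 2.
Proof.
by rewrite /ddlog_scale sp_neq0 mulr0n mul0r add0r mulrN1 !mulN1r !mulNr sqrrN expr1n mulr1.
Qed.
End LogDerivatives.

(** * Substitution of the logarithmic derivatives *)

(** Here [b], [bt], [btt], [bi], [bti], [bij] stand for [A] and its derivatives
    at a point, with [bs] and [bss] for the spatial gradient and Hessian, and
    [d] for the Kronecker delta.  Each left-hand side is a component in [u], [v]
    after substitution. *)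
Section ComponentAlgebra.
Set Implicit Arguments.
Unset Strict Implicit.
Variables (R : realType) (b : R).
Hypothesis dp : 1 + 2 * b != 0.
Hypothesis dm : 1 - 2 * b != 0.

Let dpm : 1 - 4 * b ^+ 2 != 0.
Proof.
by rewrite (_ : _ - _ = (1 + 2 * b) * (1 - 2 * b)) ?mulf_neq0 //; ring.
Qed.

Lemma space_algebra (d H H' bt btt bi bj bij : R) (bs : 'I_3 -> R) (bss : 'I_3 -> 'I_3 -> R) :
  - (bij / (1 + 2 * b) - 2 * bi * bj / (1 + 2 * b) ^+ 2
     + (- (bij / (1 - 2 * b)) - 2 * bi * bj / (1 - 2 * b) ^+ 2))
  - bi / (1 + 2 * b) * (bj / (1 + 2 * b))
  + bi / (1 + 2 * b) * - (bj / (1 - 2 * b))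
  + bj / (1 + 2 * b) * - (bi / (1 - 2 * b))
  + - (bi / (1 - 2 * b)) * - (bj / (1 - 2 * b))
  + d * (((1 + 2 * b) / (1 - 2 * b))^-1
         * (2 * (H + bt / (1 + 2 * b)) * (H - bt / (1 - 2 * b))
            - 2 * (H' - btt / (1 - 2 * b) - 2 * bt ^+ 2 / (1 - 2 * b) ^+ 2)
            - 3 * (H - bt / (1 - 2 * b)) ^+ 2)
         + \sum_k (bss k k / (1 + 2 * b) - 2 * bs k * bs k / (1 + 2 * b) ^+ 2
                   + (bs k / (1 + 2 * b)) ^+ 2
                   + (- (bss k k / (1 - 2 * b))
                      - 2 * bs k * bs k / (1 - 2 * b) ^+ 2)))
  = 2 / (1 - 4 * b ^+ 2)
    * (2 * b * bij + (1 + 4 * b + 12 * b ^+ 2) / (1 - 4 * b ^+ 2) * bi * bj)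
  + d * ((1 + 2 * b)^-1
         * (2 * btt + (6 + 4 * b) / (1 + 2 * b) * H * bt
            + (6 * b - 1) / (1 - 4 * b ^+ 2) * bt ^+ 2
            - (1 - 2 * b) * (H ^+ 2 + 2 * H'))
         - (1 - 4 * b ^+ 2)^-1
           * (4 * b * (\sum_k bss k k)
              + (3 + 4 * b + 12 * b ^+ 2) / (1 - 4 * b ^+ 2) * (\sum_k bs k ^+ 2))).
Proof. by rewrite !big_ord_recl !big_ord0; field; rewrite dp dm dpm. Qed.

Lemma mixed_algebra (H bt bi bti : R) :
  - 2 * (- (bti / (1 - 2 * b)) - 2 * bi * bt / (1 - 2 * b) ^+ 2
         - bi / (1 + 2 * b) * (H - bt / (1 - 2 * b)))
  = 2 / ((1 - 2 * b) ^+ 2 * (1 + 2 * b))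
    * ((1 + 6 * b) * bt * bi + (1 - 4 * b ^+ 2) * bti + (1 - 2 * b) ^+ 2 * H * bi).
Proof. by field; rewrite dp dm. Qed.

Lemma time_algebra (H bt : R) (bs : 'I_3 -> R) (bss : 'I_3 -> 'I_3 -> R) :
  3 * (H - bt / (1 - 2 * b)) ^+ 2
  - (1 + 2 * b) / (1 - 2 * b)
    * \sum_k (2 * (- (bss k k / (1 - 2 * b))
                   - 2 * bs k * bs k / (1 - 2 * b) ^+ 2)
              + (- (bs k / (1 - 2 * b))) ^+ 2)
  = (1 + 2 * b) / (1 - 2 * b) ^+ 3
    * (\sum_k (3 * bs k ^+ 2 + 2 * (1 - 2 * b) * bss k k))
  + 3 * (H - bt / (1 - 2 * b)) ^+ 2.
Proof. by rewrite !big_ord_recl !big_ord0; field. Qed.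

Lemma raychaudhuri_algebra (H H' bt btt : R) (bs : 'I_3 -> R) (bss : 'I_3 -> 'I_3 -> R) :
  3 * (H' - btt / (1 - 2 * b) - 2 * bt ^+ 2 / (1 - 2 * b) ^+ 2
       + (H - bt / (1 - 2 * b)) ^+ 2
       - (H + bt / (1 + 2 * b)) * (H - bt / (1 - 2 * b)))
  - (1 + 2 * b) / (1 - 2 * b)
    * \sum_k (bss k k / (1 + 2 * b) - 2 * bs k * bs k / (1 + 2 * b) ^+ 2
              + (bs k / (1 + 2 * b)) ^+ 2
              + bs k / (1 + 2 * b) * - (bs k / (1 - 2 * b)))
  = 3 * (H' - (1 - 2 * b)^-1 * btt - 2 / (1 - 4 * b ^+ 2) * H * bt
         - 4 * b / ((1 - 2 * b) * (1 - 4 * b ^+ 2)) * bt ^+ 2)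
    - (1 - 2 * b)^-1
      * ((\sum_k bss k k) - 2 / (1 - 4 * b ^+ 2) * (\sum_k bs k ^+ 2)).
Proof. by rewrite !big_ord_recl !big_ord0; field; rewrite dp dm dpm. Qed.
End ComponentAlgebra.

(** * Einstein tensor of the almost FLRW metric *)

Section EinsteinTensor.
Set Implicit Arguments.
Unset Strict Implicit.

Lemma scalar_curvature_diag (R : realType) n (g : 'I_n -> 'rV[R]_n -> R) x :
  (forall i, g i x != 0) ->
  scalar_curvature (fun y => diag_mx (\row_i g i y)) x =
  \sum_i (g i x)^-1 * ricci (fun y => diag_mx (\row_i g i y)) x i i.
Proof.
move=> g0; apply: eq_bigr => i _.
rewrite invmx_diag_mx; last by move=> ?; rewrite mxE.
rewrite (bigD1 i) //= big1 ?addr0 => [|j ji].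
  by congr (_ * _); rewrite !mxE eqxx mulr1n.
by rewrite mxE eq_sym (negPf ji) mul0r.
Qed.

Variables (R : realType) (M : set 'rV[R]_4) (a : R -> R) (A : 'rV[R]_4 -> R).
Hypothesis M_open : open M.
Hypothesis a_smooth : forall (k : nat) (x : 'rV[R]_4), M x ->
  derivable (derive1n k a) (time x) 1.
Hypothesis a_gt0 : forall x : 'rV[R]_4, M x -> 0 < a (time x).
Hypothesis A_smooth : smooth_on M A.
Hypothesis A_gt : forall x : 'rV[R]_4, M x -> 0 < 1 + 2 * A x.
Hypothesis A_lt : forall x : 'rV[R]_4, M x -> 0 < 1 - 2 * A x.

Lemma lapse_sqrE : lapse_sqr a A = scale_fun a A 1.
Proof. by apply/funext => y; rewrite /lapse_sqr /scale_fun mulr1. Qed.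

Lemma spatial_scaleE : spatial_scale a A = scale_fun a A (-1).
Proof. by apply/funext => y; rewrite /spatial_scale /scale_fun mulrN1 mulNr. Qed.

Lemma weight1_neq0 y : M y -> 1 + 2 * 1 * A y != 0.
Proof. by move=> My; rewrite mulr1 gt_eqF ?A_gt. Qed.

Lemma weightN1_neq0 y : M y -> 1 + 2 * -1 * A y != 0.
Proof. by move=> My; rewrite mulrN1 mulNr gt_eqF ?A_lt. Qed.

Lemma lapse_sqr_gt0 y : M y -> 0 < lapse_sqr a A y.
Proof. by move=> My; rewrite mulr_gt0 ?exprn_gt0 ?a_gt0 ?A_gt. Qed.

Lemma spatial_scale_gt0 y : M y -> 0 < spatial_scale a A y.
Proof. by move=> My; rewrite mulr_gt0 ?exprn_gt0 ?a_gt0 ?A_lt. Qed.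

Let g (mu : 'I_4) : 'rV[R]_4 -> R :=
  if mu == ord0 then fun y => - lapse_sqr a A y else spatial_scale a A.

Lemma flrw_metricE : flrw_metric a A = fun y => diag_mx (\row_mu g mu y).
Proof.
apply/funext => y; congr diag_mx; apply/rowP => mu.
by rewrite !mxE /g; case: eqP.
Qed.

Lemma g_neq0 y : M y -> forall mu, g mu y != 0.
Proof.
move=> My mu; rewrite /g; case: (mu =P ord0) => _.
  by rewrite /= oppr_eq0 gt_eqF ?lapse_sqr_gt0.
by rewrite gt_eqF ?spatial_scale_gt0.
Qed.

Let u k := dlog_scale a A 1 k.
Let v k := dlog_scale a A (-1) k.

Lemma is_derive_g y mu m : M y -> is_derive y (delta_mx 0 m) (g mu)
  (2 * g mu y * (if mu == ord0 then u m y else v m y)).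
Proof.
move=> My; rewrite /g; case: eqP => _.
  rewrite mulrN mulNr lapse_sqrE; apply: is_deriveN.
  exact: (is_derive_scale a_smooth a_gt0 A_smooth m My (weight1_neq0 My)).
rewrite spatial_scaleE.
exact: (is_derive_scale a_smooth a_gt0 A_smooth m My (weightN1_neq0 My)).
Qed.

Lemma half_dlog_g y mu k : M y ->
  half_dlog k (g mu) y = if mu == ord0 then u k y else v k y.
Proof.
move=> My; rewrite /half_dlog /partial.
rewrite (@derive_val _ _ _ _ _ _ _ (is_derive_g mu k My)).
by have := g_neq0 My mu => g0; field.
Qed.

Variable x : 'rV[R]_4.
Hypothesis Mx : M x.

Let U m k := ddlog_scale a A 1 m k x.
Let V m k := ddlog_scale a A (-1) m k x.
Let q := lapse_sqr a A x / spatial_scale a A x.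

Lemma ricci_flrw i j : ricci (flrw_metric a A) x i j =
  diag_ricci (fun i => if i == ord0 then u^~ x else v^~ x)
    (fun i => if i == ord0 then U else V)
    (fun i k => if i == ord0 then if k == ord0 then 1 else - q
                else if k == ord0 then - q^-1 else 1) i j.
Proof.
have dlg mu k m : is_derive x (delta_mx 0 m) (half_dlog k (g mu))
    ((if mu == ord0 then U else V) k m).
  apply: (@near_eq_is_derive _ _ _ (if mu == ord0 then u k else v k)).
    apply: (near_chart M_open) Mx => y My; rewrite half_dlog_g //.
    by case: eqP.
  rewrite /u /v /U /V; case: eqP => _.
    exact: (is_derive_dlog_scale a_smooth a_gt0 A_smooth k m Mx (weight1_neq0 Mx)).
  exact: (is_derive_dlog_scale a_smooth a_gt0 A_smooth k m Mx (weightN1_neq0 Mx)).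
have dg mu m : derivable (g mu) x (delta_mx 0 m) by have [] := is_derive_g mu m Mx.
have g0 : \forall y \near x, forall mu, g mu y != 0.
  by apply: (near_chart M_open) Mx => y; exact: g_neq0.
rewrite flrw_metricE (ricci_diag g0 dg dlg).
congr (diag_ricci _ _ _ i j); apply/funext => mu; apply/funext => k.
  by rewrite half_dlog_g //; case: eqP.
have N0 := gt_eqF (lapse_sqr_gt0 Mx); have S0 := gt_eqF (spatial_scale_gt0 Mx).
rewrite /g /q; case: eqP => _; case: eqP => _; rewrite /= ?invrN ?mulrN ?mulNr ?opprK //.
- by rewrite divff ?N0.
- by rewrite invf_div.
- by rewrite divff ?S0.
Qed.


Let N0 : lapse_sqr a A x != 0. Proof. by rewrite gt_eqF ?lapse_sqr_gt0. Qed.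
Let S0 : spatial_scale a A x != 0. Proof. by rewrite gt_eqF ?spatial_scale_gt0. Qed.
Let qV : q * q^-1 = 1. Proof. by rewrite mulfV // mulf_neq0 ?invr_neq0. Qed.
Let UC m k : U m k = U k m.
Proof. exact: (ddlog_scaleC a M_open A_smooth 1 m k Mx). Qed.
Let VC m k : V m k = V k m.
Proof. exact: (ddlog_scaleC a M_open A_smooth (-1) m k Mx). Qed.

Lemma scalar_curvature_flrw : scalar_curvature (flrw_metric a A) x =
  - (lapse_sqr a A x)^-1 * ricci (flrw_metric a A) x ord0 ord0
  + (spatial_scale a A x)^-1 * \sum_k ricci (flrw_metric a A) x (sp k) (sp k).
Proof.
rewrite flrw_metricE scalar_curvature_diag; last exact: g_neq0.
by rewrite big_ord_recl /g /= invrN mulr_sumr.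
Qed.

Lemma flrw_metric00 : flrw_metric a A x ord0 ord0 = - lapse_sqr a A x.
Proof. by rewrite !mxE. Qed.

Lemma flrw_metrics0 i : flrw_metric a A x (sp i) ord0 = 0.
Proof. by rewrite !mxE. Qed.

Lemma flrw_metric0s i : flrw_metric a A x ord0 (sp i) = 0.
Proof. by rewrite !mxE. Qed.

Lemma flrw_metricss i j :
  flrw_metric a A x (sp i) (sp j) = (i == j)%:R * spatial_scale a A x.
Proof. by rewrite !mxE eq_sp /= mulr_natl. Qed.

Lemma einstein_tensorE i j : einstein_tensor (flrw_metric a A) x i j =
  ricci (flrw_metric a A) x i j
  - 2^-1 * scalar_curvature (flrw_metric a A) x * flrw_metric a A x i j.
Proof. by rewrite /einstein_tensor !mxE. Qed.

Lemma einstein_flrw00 : einstein_tensor (flrw_metric a A) x ord0 ord0 =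
  3 * v ord0 x ^+ 2 - q * \sum_k (2 * V (sp k) (sp k) + v (sp k) x ^+ 2).
Proof.
rewrite einstein_tensorE scalar_curvature_flrw flrw_metric00 ricci_flrw.
under eq_bigr do rewrite ricci_flrw.
exact: (isotropic_einstein00 (u^~ x) (v^~ x) N0 S0 UC VC).
Qed.

Lemma einstein_flrws0 i : einstein_tensor (flrw_metric a A) x (sp i) ord0 =
  - 2 * (V (sp i) ord0 - u (sp i) x * v ord0 x).
Proof.
rewrite einstein_tensorE flrw_metrics0 mulr0 subr0 ricci_flrw [V _ _]VC.
exact: (isotropic_riccis0 (u^~ x) (v^~ x) qV UC VC).
Qed.

Lemma einstein_flrw0s i : einstein_tensor (flrw_metric a A) x ord0 (sp i) =
  - 2 * (V (sp i) ord0 - u (sp i) x * v ord0 x).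
Proof.
rewrite einstein_tensorE flrw_metric0s mulr0 subr0 ricci_flrw [V _ _]VC.
exact: (isotropic_ricci0s (u^~ x) (v^~ x) V qV UC).
Qed.

Lemma einstein_flrwss i j : einstein_tensor (flrw_metric a A) x (sp i) (sp j) =
  - (U (sp i) (sp j) + V (sp i) (sp j)) - u (sp i) x * u (sp j) x
  + u (sp i) x * v (sp j) x + u (sp j) x * v (sp i) x + v (sp i) x * v (sp j) x
  + (i == j)%:R * (q^-1 * (2 * u ord0 x * v ord0 x - 2 * V ord0 ord0 - 3 * v ord0 x ^+ 2)
    + \sum_k (U (sp k) (sp k) + u (sp k) x ^+ 2 + V (sp k) (sp k))).
Proof.
rewrite einstein_tensorE scalar_curvature_flrw flrw_metricss !ricci_flrw.
under eq_bigr do rewrite ricci_flrw.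
exact: (isotropic_einsteinss (u^~ x) (v^~ x) N0 S0 UC VC).
Qed.

Let dp : 1 + 2 * A x != 0. Proof. by rewrite gt_eqF ?A_gt. Qed.
Let dm : 1 - 2 * A x != 0. Proof. by rewrite gt_eqF ?A_lt. Qed.

Lemma lapse_space_ratio :
  lapse_sqr a A x / spatial_scale a A x = (1 + 2 * A x) / (1 - 2 * A x).
Proof.
have a0 : a (time x) != 0 by rewrite gt_eqF ?a_gt0.
by rewrite /lapse_sqr /spatial_scale; field; rewrite a0 dm.
Qed.

Lemma einstein_tensor_space i j :
  einstein_tensor (flrw_metric a A) x (sp i) (sp j) =
  2 / (1 - 4 * A x ^+ 2)
  * (2 * A x * d_sp j (d_sp i A) x
     + (1 + 4 * A x + 12 * A x ^+ 2) / (1 - 4 * A x ^+ 2)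
       * d_sp i A x * d_sp j A x)
  + (i == j)%:R
    * ((1 + 2 * A x)^-1
       * (2 * d_tau (d_tau A) x
          + (6 + 4 * A x) / (1 + 2 * A x) * hubble a (time x) * d_tau A x
          + (6 * A x - 1) / (1 - 4 * A x ^+ 2) * d_tau A x ^+ 2
          - (1 - 2 * A x)
            * (hubble a (time x) ^+ 2 + 2 * derive1 (hubble a) (time x)))
       - (1 - 4 * A x ^+ 2)^-1
         * (4 * A x * (\sum_k d_sp k (d_sp k A) x)
            + (3 + 4 * A x + 12 * A x ^+ 2) / (1 - 4 * A x ^+ 2)
              * (\sum_k d_sp k A x ^+ 2))).
Proof.
rewrite einstein_flrwss /q lapse_space_ratio /u /v /U /V.
rewrite dlog_lapse_tau dlog_space_tau !dlog_lapse_sp !dlog_space_sp.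
rewrite ddlog_space_tau // ddlog_lapse_sp ddlog_space_sp.
under eq_bigr do rewrite ddlog_lapse_sp ddlog_space_sp dlog_lapse_sp.
exact: (space_algebra dp dm _ _ _ _ _ _ _ _
  (fun k => d_sp k A x) (fun k l => d_sp l (d_sp k A) x)).
Qed.

Lemma einstein_tensor_mixed i :
  einstein_tensor (flrw_metric a A) x (sp i) ord0 =
  2 / ((1 - 2 * A x) ^+ 2 * (1 + 2 * A x))
  * ((1 + 6 * A x) * d_tau A x * d_sp i A x
     + (1 - 4 * A x ^+ 2) * d_tau (d_sp i A) x
     + (1 - 2 * A x) ^+ 2 * hubble a (time x) * d_sp i A x).
Proof.
rewrite einstein_flrws0 /u /v /V.
rewrite ddlog_space_sp_tau dlog_lapse_sp dlog_space_tau.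
exact: mixed_algebra.
Qed.

Lemma einstein_tensor_sym i :
  einstein_tensor (flrw_metric a A) x ord0 (sp i) =
  einstein_tensor (flrw_metric a A) x (sp i) ord0.
Proof. by rewrite einstein_flrw0s einstein_flrws0. Qed.

Lemma einstein_tensor_time :
  einstein_tensor (flrw_metric a A) x ord0 ord0 =
  (1 + 2 * A x) / (1 - 2 * A x) ^+ 3
  * (\sum_k (3 * d_sp k A x ^+ 2
              + 2 * (1 - 2 * A x) * d_sp k (d_sp k A) x))
  + 3 * (hubble a (time x) - d_tau A x / (1 - 2 * A x)) ^+ 2.
Proof.
rewrite einstein_flrw00 /q lapse_space_ratio /v /V dlog_space_tau.
under eq_bigr do rewrite ddlog_space_sp dlog_space_sp.
exact: (time_algebra dm _ _
  (fun k => d_sp k A x) (fun k l => d_sp l (d_sp k A) x)).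
Qed.

End EinsteinTensor.

(** * Kinematics of the slices *)

Section Raychaudhuri.
Set Implicit Arguments.
Unset Strict Implicit.
Variables (R : realType) (M : set 'rV[R]_4) (a : R -> R) (A : 'rV[R]_4 -> R).
Hypothesis M_open : open M.
Hypothesis a_smooth : forall (k : nat) (x : 'rV[R]_4), M x ->
  derivable (derive1n k a) (time x) 1.
Hypothesis a_gt0 : forall x : 'rV[R]_4, M x -> 0 < a (time x).
Hypothesis A_smooth : smooth_on M A.
Hypothesis A_gt : forall x : 'rV[R]_4, M x -> 0 < 1 + 2 * A x.
Hypothesis A_lt : forall x : 'rV[R]_4, M x -> 0 < 1 - 2 * A x.
Implicit Types (y : 'rV[R]_4).

Let h := spatial_metric a A.
Let S := spatial_scale a A.
Let N := lapse_sqr a A.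
Let u k := dlog_scale a A 1 k.
Let v k := dlog_scale a A (-1) k.

Let S0 y : M y -> S y != 0.
Proof. by move=> My; rewrite gt_eqF ?(spatial_scale_gt0 a_gt0 A_lt). Qed.

Let dS y m : M y -> is_derive y (delta_mx 0 m) S (2 * S y * v m y).
Proof.
move=> My; rewrite /S spatial_scaleE.
exact: (is_derive_scale a_smooth a_gt0 A_smooth m My (weightN1_neq0 A_lt My)).
Qed.

Let dN y m : M y -> is_derive y (delta_mx 0 m) N (2 * N y * u m y).
Proof.
move=> My; rewrite /N lapse_sqrE.
exact: (is_derive_scale a_smooth a_gt0 A_smooth m My (weight1_neq0 A_gt My)).
Qed.

Let dv y m k : M y ->
  is_derive y (delta_mx 0 k) (v m) (ddlog_scale a A (-1) m k y).
Proof.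
by move=> My; exact: (is_derive_dlog_scale a_smooth a_gt0 A_smooth m k My
  (weightN1_neq0 A_lt My)).
Qed.

Let du y m k : M y ->
  is_derive y (delta_mx 0 k) (u m) (ddlog_scale a A 1 m k y).
Proof.
by move=> My; exact: (is_derive_dlog_scale a_smooth a_gt0 A_smooth m k My
  (weight1_neq0 A_gt My)).
Qed.

Lemma expansion_tensor_flrw y : M y -> expansion_tensor h y = (S y * v ord0 y)%:M.
Proof.
move=> My; apply/matrixP => i j; rewrite !mxE.
have -> : (fun z => h z i j) = (fun z => (i == j)%:R * S z).
  by apply/funext => z; rewrite /h /spatial_metric mxE mulr_natl.
have := is_deriveZ ((i == j)%:R : R) (dS ord0 My).
move=> /(@derive_val _ _ _ _ _ _ _); rewrite /d_tau /partial => ->.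
by rewrite /GRing.scale /=; case: (i == j) => /=; rewrite ?mulr1n ?mulr0n; field.
Qed.

Lemma expansion_flrw y : M y -> expansion h y = 3 * v ord0 y.
Proof.
move=> My; have := S0 My => s0; rewrite /expansion expansion_tensor_flrw //.
rewrite /h /spatial_metric invmx_scalar !big_ord_recl !big_ord0 !mxE /=.
by rewrite -/S; field.
Qed.

Lemma shear_flrw y : M y -> shear h y = 0.
Proof.
move=> My; apply/matrixP => i j.
rewrite /shear expansion_tensor_flrw // expansion_flrw // !mxE -/S.
by case: (i == j) => /=; rewrite ?mulr1n ?mulr0n -/(S y); field.
Qed.

Lemma shear_sqr_flrw y : M y -> shear_sqr h y = 0.
Proof.
move=> My; rewrite /shear_sqr shear_flrw //.
by do 4!(apply: big1 => ? _); rewrite !mxE mulr0.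
Qed.

(** The square root halves the logarithmic derivative, so that [Psi] and
    [b_i] are components of the gradient of [log N / 2]. *)
Lemma dlog_lapse y m : M y ->
  (lapse a A y)^-1 * partial m (lapse a A) y = u m y.
Proof.
move=> My; have N0 : 0 < N y := lapse_sqr_gt0 a_gt0 A_gt My.
have := @is_derive_sqrt_comp _ _ _ _ _ _ N0 (dN m My).
move=> /(@derive_val _ _ _ _ _ _ _); rewrite /partial => ->.
have r0 : Num.sqrt (N y) != 0 by rewrite gt_eqF ?sqrtr_gt0.
have := esym (sqr_sqrtr (ltW N0)).
rewrite -[lapse a A y]/(Num.sqrt (N y)).
by move: (Num.sqrt _) r0 => r r0 ->; field.
Qed.

Lemma b_upper_flrw k y : M y ->
  b_upper h (lapse a A) k y = (S y)^-1 * u (sp k) y.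
Proof.
move=> My; rewrite /b_upper (bigD1 k) //= big1 ?addr0 => [|i ik].
  by rewrite /h /spatial_metric invmx_scalar mxE eqxx mulr1n /b_lower dlog_lapse.
by rewrite /h /spatial_metric invmx_scalar mxE eq_sym (negPf ik) mul0r.
Qed.

Lemma b_sqr_flrw y : M y ->
  b_sqr h (lapse a A) y = (S y)^-1 * \sum_k u (sp k) y ^+ 2.
Proof.
move=> My; rewrite /b_sqr mulr_sumr; apply: eq_bigr => k _.
under eq_bigr do rewrite mulrAC.
rewrite -mulr_suml -/(b_upper h (lapse a A) k y) b_upper_flrw //.
by rewrite /b_lower dlog_lapse // expr2 mulrA.
Qed.

Variable x : 'rV[R]_4.
Hypothesis Mx : M x.

(** On a slice the metric is conformally flat, and the contraction that enters
    a divergence is the gradient of [log S / 2]; summed over [k] it gives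
    that of [log (S ^+ 3) / 2]. *)
Lemma christoffel_slice k l :
  christoffel (fun z => h (event (time x) z)) k k l (position x) = v (sp l) x.
Proof.
have -> : (fun z => h (event (time x) z)) =
    (fun z => diag_mx (\row_(i < 3) S (event (time x) z))).
  apply/funext => z; rewrite /h /spatial_metric -diag_const_mx; congr diag_mx.
  by apply/rowP => i; rewrite !mxE.
have s0 := S0 Mx.
rewrite (@christoffel_diag _ _ (fun _ z => S (event (time x) z))) => [|_]; last first.
  by rewrite event_time_position.
rewrite /diag_chr /half_dlog !partial_slice event_time_position eqxx.
have dSv m : partial m S x = 2 * S x * v m x by exact: (@derive_val _ _ _ _ _ _ _ (dS m Mx)).
rewrite !dSv; case: (eqVneq l k) => [->|_] /=; last by rewrite mulr0n mulr1n; field.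
by rewrite mulr1n; field.
Qed.

Lemma b_div_flrw : b_div h (lapse a A) x =
  (S x)^-1 * \sum_k (ddlog_scale a A 1 (sp k) (sp k) x + u (sp k) x * v (sp k) x).
Proof.
have s0 := S0 Mx.
rewrite /b_div /divergence.
have E k : partial k (fun z => b_upper h (lapse a A) k (event (time x) z)) (position x)
    = (S x)^-1 * (ddlog_scale a A 1 (sp k) (sp k) x - 2 * v (sp k) x * u (sp k) x).
  rewrite partial_slice.
  have -> : partial (sp k) (b_upper h (lapse a A) k) x =
      partial (sp k) (fun y => (S y)^-1 * u (sp k) y) x.
    apply: near_eq_derive; apply: (near_chart M_open) Mx => y.
    exact: b_upper_flrw.
  have dSV : is_derive x (delta_mx 0 (sp k)) (fun y => (S y)^-1)
      (- (S x) ^- 2 *: (2 * S x * v (sp k) x)).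
    have [ds <-] := dS (sp k) Mx.
    by apply: DeriveDef; [exact: derivableV | exact: deriveV].
  have := is_deriveM dSV (du (sp k) (sp k) Mx).
  move=> /(@derive_val _ _ _ _ _ _ _); rewrite /partial => ->.
  by rewrite /GRing.scale /=; field.
under eq_bigr => k _ do rewrite E.
under eq_bigr => k _ do under eq_bigr => l _ do
  rewrite christoffel_slice event_time_position b_upper_flrw //.
have trace (U u' v' : 'I_3 -> R) :
    \sum_k ((S x)^-1 * (U k - 2 * v' k * u' k) + \sum_l v' l * ((S x)^-1 * u' l))
    = (S x)^-1 * \sum_k (U k + u' k * v' k).
  by rewrite !big_ord_recl !big_ord0; field.
exact: trace (fun k => ddlog_scale a A 1 (sp k) (sp k) x) (fun k => u (sp k) x) (fun k => v (sp k) x).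
Qed.

Lemma raychaudhuri_flrw Lambda G rho p :
  raychaudhuri_ehlers h (lapse a A) (fun=> 0) Lambda G rho p x <->
  3 * (ddlog_scale a A (-1) ord0 ord0 x + v ord0 x ^+ 2 - u ord0 x * v ord0 x)
  - N x / S x * \sum_k (ddlog_scale a A 1 (sp k) (sp k) x + u (sp k) x ^+ 2
                        + u (sp k) x * v (sp k) x)
  = N x * (Lambda - 4 * pi * G * (rho x + 3 * p x)).
Proof.
rewrite /raychaudhuri_ehlers shear_sqr_flrw // expansion_flrw // b_sqr_flrw //.
rewrite b_div_flrw.
have -> : Psi (lapse a A) x = u ord0 x by exact: dlog_lapse.
have -> : d_tau (expansion h) x = 3 * ddlog_scale a A (-1) ord0 ord0 x.
  have -> : d_tau (expansion h) x = partial ord0 (fun y => 3 * v ord0 y) x.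
    apply: near_eq_derive; apply: (near_chart M_open) Mx => y; exact: expansion_flrw.
  exact: (@derive_val _ _ _ _ _ _ _ (is_deriveZ (3 : R) (dv ord0 ord0 Mx))).
rewrite /lapse sqr_sqrtr; last exact/ltW/(lapse_sqr_gt0 a_gt0 A_gt Mx).
have s0 := S0 Mx.
have alg (n s dv0 v0 u0 b d m : R) : s != 0 ->
    3 * dv0 + 3^-1 * (3 * v0) ^+ 2 + 0 - u0 * (3 * v0)
      - n * (s^-1 * b + s^-1 * d + n * 0 + Lambda - m) = 0 <->
    3 * (dv0 + v0 ^+ 2 - u0 * v0) - n / s * (b + d) = n * (Lambda - m).
  move=> s0'; set lhs := (X in X = 0 <-> _).
  have -> : lhs = 3 * (dv0 + v0 ^+ 2 - u0 * v0) - n / s * (b + d) - n * (Lambda - m).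
    by rewrite /lhs; field.
  by split=> [/subr0_eq //|->]; exact: subrr.
rewrite alg // -big_split /=.
by under eq_bigr do rewrite addrCA addrA.
Qed.

Lemma raychaudhuri_equation Lambda G rho p :
  raychaudhuri_ehlers h (lapse a A) (fun=> 0) Lambda G rho p x <->
  3 * (derive1 (hubble a) (time x) - (1 - 2 * A x)^-1 * d_tau (d_tau A) x
       - 2 / (1 - 4 * A x ^+ 2) * hubble a (time x) * d_tau A x
       - 4 * A x / ((1 - 2 * A x) * (1 - 4 * A x ^+ 2)) * d_tau A x ^+ 2)
  - (1 - 2 * A x)^-1
    * ((\sum_k d_sp k (d_sp k A) x)
       - 2 / (1 - 4 * A x ^+ 2) * (\sum_k d_sp k A x ^+ 2))
  = N x * (Lambda - 4 * pi * G * (rho x + 3 * p x)).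
Proof.
have dp : 1 + 2 * A x != 0 by rewrite gt_eqF ?A_gt.
have dm : 1 - 2 * A x != 0 by rewrite gt_eqF ?A_lt.
rewrite -(raychaudhuri_algebra dp dm _ _ _ _
  (fun k => d_sp k A x) (fun k l => d_sp l (d_sp k A) x)).
rewrite raychaudhuri_flrw.
rewrite /N /S (lapse_space_ratio a_gt0 A_lt Mx) /u /v.
rewrite ddlog_space_tau // dlog_space_tau dlog_lapse_tau.
by under eq_bigr do rewrite ddlog_lapse_sp dlog_lapse_sp dlog_space_sp.
Qed.

End Raychaudhuri.

(** * The field equations *)

Theorem theorem9p2 (R : realType) (M : set 'rV[R]_4)
  (a : R -> R) (A rho p : 'rV[R]_4 -> R) (Lambda G : R)
  (M_open : open M)
  (a_smooth : forall (k : nat) (x : 'rV[R]_4), M x ->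
     derivable (derive1n k a) (time x) 1)
  (a_gt0 : forall x : 'rV[R]_4, M x -> 0 < a (time x))
  (A_smooth : smooth_on M A)
  (A_gt : forall x : 'rV[R]_4, M x -> 0 < 1 + 2 * A x)
  (A_lt : forall x : 'rV[R]_4, M x -> 0 < 1 - 2 * A x) :
  forall x : 'rV[R]_4, M x ->
  let einstein_eq := fun mu nu : 'I_4 =>
    einstein_equation (flrw_metric a A) (perfect_fluid a A rho p)
      Lambda G mu nu x in
  let A0 := A x in
  let A' := d_tau A x in
  let A'' := d_tau (d_tau A) x in
  let A_ := fun i : 'I_3 => d_sp i A x in
  let A_' := fun i : 'I_3 => d_tau (d_sp i A) x in
  let A__ := fun i j : 'I_3 => d_sp j (d_sp i A) x in
  let a0 := a (time x) in
  let H := hubble a (time x) in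
  let H' := derive1 (hubble a) (time x) in
  [/\ ((forall mu nu : 'I_4, einstein_eq mu nu) <->
       [/\ forall i j : 'I_3, einstein_eq (sp i) (sp j),
           forall i : 'I_3, einstein_eq (sp i) ord0
         & einstein_eq ord0 ord0]),
      (forall i j : 'I_3, einstein_eq (sp i) (sp j) <->
         2 / (1 - 4 * A0 ^+ 2) *
           (2 * A0 * A__ i j
            + (1 + 4 * A0 + 12 * A0 ^+ 2) / (1 - 4 * A0 ^+ 2) * A_ i * A_ j)
         + (i == j)%:R *
           ((1 + 2 * A0)^-1 *
              (2 * A'' + (6 + 4 * A0) / (1 + 2 * A0) * H * A'
               + (6 * A0 - 1) / (1 - 4 * A0 ^+ 2) * A' ^+ 2
               - (1 - 2 * A0) * (H ^+ 2 + 2 * H'))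
            - (1 - 4 * A0 ^+ 2)^-1 *
              (4 * A0 * (\sum_k A__ k k)
               + (3 + 4 * A0 + 12 * A0 ^+ 2) / (1 - 4 * A0 ^+ 2)
                 * (\sum_k A_ k ^+ 2)))
         = (8 * pi * G * p x - Lambda) * a0 ^+ 2 * (1 - 2 * A0) * (i == j)%:R),
      (forall i : 'I_3, einstein_eq (sp i) ord0 <->
         (1 + 6 * A0) * A' * A_ i + (1 - 4 * A0 ^+ 2) * A_' i
         + (1 - 2 * A0) ^+ 2 * H * A_ i = 0),
      (einstein_eq ord0 ord0 <->
         (1 + 2 * A0) / (1 - 2 * A0) ^+ 3 *
           (\sum_k (3 * A_ k ^+ 2 + 2 * (1 - 2 * A0) * A__ k k))
         + 3 * (H - A' / (1 - 2 * A0)) ^+ 2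
         = a0 ^+ 2 * (1 + 2 * A0) * (Lambda + 8 * pi * G * rho x))
    & (raychaudhuri_ehlers (spatial_metric a A) (lapse a A)
         (fun=> 0) Lambda G rho p x <->
         3 * (H' - (1 - 2 * A0)^-1 * A''
              - 2 / (1 - 4 * A0 ^+ 2) * H * A'
              - 4 * A0 / ((1 - 2 * A0) * (1 - 4 * A0 ^+ 2)) * A' ^+ 2)
         - (1 - 2 * A0)^-1 *
           ((\sum_k A__ k k) - 2 / (1 - 4 * A0 ^+ 2) * (\sum_k A_ k ^+ 2))
         = a0 ^+ 2 * (1 + 2 * A0) *
           (Lambda - 4 * pi * G * (rho x + 3 * p x)))].
Proof.
move=> x Mx ee A0 A' A'' A_ A_' A__ a0 H H'.
have moveR (s m t r : R) : t = r + m -> (s + m = t <-> s = r).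
  by move=> ->; split=> [/addIr|->].
have T0s i : perfect_fluid a A rho p x ord0 (sp i) = 0 by rewrite !mxE.
have Ts0 i : perfect_fluid a A rho p x (sp i) ord0 = 0 by rewrite !mxE.
have T00 : perfect_fluid a A rho p x ord0 ord0 = lapse_sqr a A x * rho x.
  by rewrite !mxE.
have Tss i j : perfect_fluid a A rho p x (sp i) (sp j)
    = (i == j)%:R * (p x * spatial_scale a A x).
  by rewrite !mxE eq_sp mulr_natl.
split.
- split=> [eqs|[ess es0 e00] mu nu]; first by split=> *; exact: eqs.
  case: (unliftP ord0 mu) => [i ->|->]; case: (unliftP ord0 nu) => [j ->|->] //.
  (* What is left are the [0i] components, where the symmetry of the Einstein
     tensor is needed. *)
  have := es0 j; rewrite /ee /einstein_equation -/(sp j).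
  rewrite T0s Ts0 flrw_metric0s flrw_metrics0.
  by rewrite (einstein_tensor_sym M_open a_smooth a_gt0 A_smooth A_gt A_lt Mx).
- move=> i j; rewrite /ee /einstein_equation Tss flrw_metricss.
  rewrite (einstein_tensor_space M_open a_smooth a_gt0 A_smooth A_gt A_lt Mx).
  by apply: moveR; rewrite /spatial_scale -/A0 -/a0; ring.
- move=> i; rewrite /ee /einstein_equation Ts0 flrw_metrics0 !mulr0 addr0.
  rewrite (einstein_tensor_mixed M_open a_smooth a_gt0 A_smooth A_gt A_lt Mx).
  set c := (X in X * _ = 0); have c0 : c != 0.
    by rewrite gt_eqF // divr_gt0 // mulr_gt0 ?exprn_gt0 ?A_gt ?A_lt.
  split=> [/eqP|->]; last by rewrite mulr0.
  by rewrite mulf_eq0 (negPf c0) => /eqP.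
- rewrite /ee /einstein_equation T00 flrw_metric00.
  rewrite (einstein_tensor_time M_open a_smooth a_gt0 A_smooth A_gt A_lt Mx).
  by apply: moveR; rewrite /lapse_sqr -/A0 -/a0; ring.
- exact: (raychaudhuri_equation M_open a_smooth a_gt0 A_smooth A_gt A_lt Mx).
Qed.
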